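(* Let $(\mathcal X,\rho)$ be a separable metric space, let $\Xi$ be a second-countable locally compact Hausdorff space, let $\kappa:\mathcal X\times\Xi\to\mathbb R$ be an $(L,\rho)$-Lipschitz I-RKBS kernel, and let $(\mathcal U,\|\cdot\|_{\mathcal U})$ be the corresponding I-RKBS. Fix distinct data sites $x_1,\dots,x_N\in\mathcal X$ and let $G:\mathbb R^N\to[0,+\infty]$ be proper, lower semicontinuous, and coercive. For $\lambda>0$, consider the problem $$\min_{f\in\mathcal U}G\big(f(x_1),\dots,f(x_N)\big)+\lambda\|f\|_{\mathcal U}.\qquad(\mathrm P)$$ Then, if the objective is proper, the solution set is nonempty and there exists a minimizer $f^\star$ of $(\mathrm P)$ of the form $$f^\star=\sum_{j=1}^Ka_j\kappa(\cdot,\xi_j),\qquad K\le N,$$ for some $a_1,\dots,a_K\in\mathbb R$ and $\xi_1,\dots,\xi_K\in\Xi$. If we further suppose that $$\mathrm{span}\{(\kappa(x_1,\xi),\dots,\kappa(x_N,\xi)):\xi\in\Xi\}=\mathbb R^N,$$ then the objective in $(\mathrm P)$ is always proper, and for every $K\ge N$ the problem $$\min_{\substack{a_1,\dots,a_K\in\mathbb R\\\xi_1,\dots,\xi_K\in\Xi}}G\Big(\sum_{j=1}^Ka_j\kappa(x_1,\xi_j),\dots,\sum_{j=1}^Ka_j\kappa(x_N,\xi_j)\Big)+\lambda\sum_{j=1}^K|a_j|$$ has a nonempty solution set, and any solution $(a^\star,\xi^\star)\in\mathbb R^K\times\Xi^K$ induces a solution $\sum_{j=1}^Ka_j^\star\kappa(\cdot,\xi_j^\star)$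 of $(\mathrm P)$.
   Context: $C_0(\Xi)$ is the space of continuous real functions on $\Xi$ vanishing at infinity with the sup norm, and $\mathcal M(\Xi)=C_0(\Xi)'$ the finite signed Radon measures with total variation norm $\|\cdot\|_{\mathcal M}$. An I-RKBS kernel is a function $\kappa:\mathcal X\times\Xi\to\mathbb R$ with $\kappa(x,\cdot)\in C_0(\Xi)$ for all $x\in\mathcal X$ and $\mathrm{span}\{\kappa(x,\cdot):x\in\mathcal X\}$ dense in $C_0(\Xi)$. Then $T_\kappa:\nu\mapsto\int_\Xi\kappa(\cdot,\xi)\,d\nu(\xi)$ is injective on $\mathcal M(\Xi)$; the corresponding I-RKBS (integral reproducing kernel Banach space) is $\mathcal U=T_\kappa(\mathcal M(\Xi))$ with $\|T_\kappa\nu\|_{\mathcal U}=\|\nu\|_{\mathcal M}$. $\kappa$ is $(L,\rho)$-Lipschitz if $\|\kappa(x,\cdot)-\kappa(z,\cdot)\|_{L^\infty}\le L\rho(x,z)$ for all $x,z\in\mathcal X$. $G$ coercive means its sublevel sets are bounded; proper means finite somewhere. *)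

(* Defs.v *)
From mathcomp Require Export all_boot all_order all_algebra.
From mathcomp Require Export all_classical all_reals all_analysis.
Export numFieldNormedType.Exports.

Set Implicit Arguments.
Unset Strict Implicit.
Unset Printing Implicit Defensive.

Import Order.TTheory GRing.Theory Num.Theory.

Local Open Scope classical_set_scope.
Local Open Scope ring_scope.

Definition separable (X : topologicalType) : Prop :=
  exists2 D : set X, countable D & dense D.

Section span.
Context {R : realType} {V : lmodType R}.

Definition lin_span (A : set V) : set V :=
  [set v | exists n (c : 'I_n -> R) (u : 'I_n -> V),
     (forall i, A (u i)) /\ v = \sum_(i < n) c i *: u i].

End span.

Section C0.
Context {R : realType} {Xi : topologicalType}.

Definition C0 : set (Xi -> R) :=
  [set g | continuous g /\
     forall e : R, 0 < e -> compact [set xi | e <= `|g xi|]].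

(* For unbounded [g], [sup] is a junk value; elements of [C0] are bounded. *)
Definition sup_norm (g : Xi -> R) : R := sup (range (fun xi => `|g xi|)).

Definition dense_in_C0 (A : set (Xi -> R)) : Prop :=
  forall g, C0 g -> forall e : R, 0 < e ->
  exists2 h, A h & sup_norm (g - h) < e.

End C0.

(* [Xi] with its Borel sigma-algebra. *)
Notation borel Xi := (g_sigma_algebraType (@open Xi)).

(* Library charges are finite-valued: [signed_measure R Xi] is the type of
   finite signed Borel measures on [Xi]. *)
Notation signed_measure R Xi := (charge (borel Xi) R).

Section signed_measures.
Context {R : realType} {Xi : ptopologicalType}.
Implicit Type nu : signed_measure R Xi.

Lemma hahn_sets_ex nu :
  exists PN : set (borel Xi) * set (borel Xi),
    hahn_decomposition nu PN.1 PN.2.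
Proof. by have [P [N h]] := Hahn_decomposition nu; exists (P, N). Qed.

(* A chosen Hahn decomposition; the Jordan parts do not depend on it. *)
Definition hahn_sets nu := projT1 (cid (hahn_sets_ex nu)).

Definition hahn_setsP nu :
    hahn_decomposition nu (hahn_sets nu).1 (hahn_sets nu).2 :=
  projT2 (cid (hahn_sets_ex nu)).

Definition pos_part nu : {measure set (borel Xi) -> \bar R} :=
  jordan_pos (hahn_setsP nu).

Definition neg_part nu : {measure set (borel Xi) -> \bar R} :=
  jordan_neg (hahn_setsP nu).

Definition variation nu : {measure set (borel Xi) -> \bar R} :=
  charge_variation (hahn_setsP nu).

Definition tv_norm nu : R := fine (variation nu setT).

Definition charge_integral nu (g : Xi -> R) : R :=
  \int[pos_part nu]_xi g xi - \int[neg_part nu]_xi g xi.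

(* Inner regularity of the finite measure [variation nu] on all Borel sets;
   by taking complements, this also yields outer regularity. *)
Definition radon nu : Prop :=
  forall A : set (borel Xi), measurable A -> forall e : R, 0 < e ->
  exists C : set Xi,
    [/\ compact C, C `<=` A & (variation nu (A `\` C) < e%:E)%E].

End signed_measures.

Section irkbs.
Context {R : realType} {X : Type} {Xi : ptopologicalType}.
Variable kappa : X -> Xi -> R.

Definition irkbs_kernel : Prop :=
  (forall x, C0 (kappa x)) /\ dense_in_C0 (lin_span (range kappa)).

Definition Tk (nu : signed_measure R Xi) : X -> R :=
  fun x => charge_integral nu (kappa x).

Definition irkbs : set (X -> R) := Tk @` [set nu | radon nu].

(* When [kappa] is an I-RKBS kernel, [Tk] is injective on Radon measures, so
   for [f] in [irkbs] the set below is the singleton of the total variation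
   norm of the unique representing measure; [get] picks its element. *)
Definition irkbs_norm (f : X -> R) : R :=
  get (tv_norm @` [set nu | radon nu /\ Tk nu = f]).

End irkbs.

Definition lipschitz_kernel {R : realType} {X : metricType R}
    {Xi : topologicalType} (L : R) (kappa : X -> Xi -> R) : Prop :=
  forall x z, sup_norm (kappa x - kappa z) <= L * mdist x z.

Section optimization.
Context {R : realType} {T : Type}.

Definition proper_on (D : set T) (J : T -> \bar R) : Prop :=
  exists2 t, D t & (J t < +oo)%E.

Definition minimizers (D : set T) (J : T -> \bar R) : set T :=
  [set t | D t /\ forall s, D s -> (J t <= J s)%E].

End optimization.

Definition coercive {R : realType} {V : normedModType R} (G : V -> \bar R) :
    Prop :=
  forall a : R, bounded_set [set v | (G v <= a%:E)%E].

Section problems.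
Context {R : realType} {X : Type} {Xi : ptopologicalType}.
Variables (kappa : X -> Xi -> R) (N : nat) (x : 'I_N -> X).
Variables (G : 'rV[R]_N -> \bar R) (lambda : R).

Definition objP (f : X -> R) : \bar R :=
  (G (\row_i f (x i)) + (lambda * irkbs_norm kappa f)%:E)%E.

Definition atomic (K : nat) (p : ('I_K -> R) * ('I_K -> Xi)) : X -> R :=
  fun z => \sum_(j < K) p.1 j * kappa z (p.2 j).

Definition objK (K : nat) (p : ('I_K -> R) * ('I_K -> Xi)) : \bar R :=
  (G (\row_i (\sum_(j < K) p.1 j * kappa (x i) (p.2 j))%R)
   + (lambda * \sum_(j < K) `|p.1 j|)%:E)%E.

End problems.

(* Main.v *)
From HB Require Import structures.
Require Import Defs.
From mathcomp Require Import measurable_realfun lra ring.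
Import Order.TTheory GRing.Theory Num.Theory.
Local Open Scope classical_set_scope.
Local Open Scope ring_scope.

(** Write phi(xi) = (kappa(x_1,xi), ..., kappa(x_N,xi)), a continuous map
    vanishing at infinity, so that phi(Xi) together with 0 is compact.
    Let v be the integral of phi against a Radon measure nu of total variation
    t, and let D be the set of N-term sums sum_j a_j phi(xi_j) with
    sum_j |a_j| <= t.  By Caratheodory's argument (a linear dependence among
    N + 1 vectors allows one of them to be dropped without increasing
    sum_j |a_j|), D is convex; it is also compact.  If v were not in D, its
    nearest point w in D would give p = v - w with t |<p, phi>| <= <p, w>
    everywhere, and integrating against nu would yield <p, v> <= <p, w>, that
    is p = 0.  Hence every element of the I-RKBS can be replaced, with the same
    values at the data sites and no larger norm, by an N-term atomic one, and
    the atomic problem has a solution by compactness and lower semicontinuity.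

    That the norm of an element does not depend on the representing measure
    follows by testing against functions of C_0(Xi) that are 1 and -1 on
    compact subsets of the two Hahn sets. *)

Set Implicit Arguments.
Unset Strict Implicit.
Unset Printing Implicit Defensive.

(** * Integration against signed measures *)

Section borel_functions.
Context {R : realType} {Xi : ptopologicalType}.
Implicit Types (g h : Xi -> R) (mu : {finite_measure set (borel Xi) -> \bar R}).

Lemma continuous_borel_measurable g :
  continuous g -> measurable_fun setT (g : borel Xi -> R).
Proof.
move=> /continuousP cg.
apply: (measurability _ (RGenOInfty.measurableE R)).
move=> _ [_ [a ->] <-]; rewrite setTI.
apply: sub_sigma_algebra; apply: cg; exact: interval_open.
Qed.

(** A class of integrands containing [C0] and the indicators of Borel sets, closed under linear
    combinations, and integrable against every finite measure. *)
Definition bounded_borel : set (Xi -> R) :=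
  [set g | measurable_fun setT (g : borel Xi -> R) /\
     exists M, forall xi, `|g xi| <= M].

Lemma bounded_borelD g h :
  bounded_borel g -> bounded_borel h -> bounded_borel (g + h).
Proof.
move=> [mg [M gM]] [mh [M' hM']]; split; first exact: measurable_funD.
by exists (M + M') => xi; rewrite (le_trans (ler_normD _ _))// lerD.
Qed.

Lemma bounded_borelZ (c : R) g : bounded_borel g -> bounded_borel (c *: g).
Proof.
move=> [mg [M gM]]; split; first exact: measurable_funM.
by exists (`|c| * M) => xi; rewrite normrM ler_wpM2l.
Qed.

Lemma bounded_borel0 : bounded_borel (0 : Xi -> R).
Proof. by split; [exact: measurable_cst | exists 0 => xi; rewrite normr0]. Qed.

Lemma bounded_borel_sum n (c : 'I_n -> R) (u : 'I_n -> Xi -> R) :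
  (forall i, bounded_borel (u i)) -> bounded_borel (\sum_i c i *: u i).
Proof.
move=> bu; apply: big_ind => [||i _].
- exact: bounded_borel0.
- exact: bounded_borelD.
- exact: bounded_borelZ.
Qed.

Lemma bounded_borel_integrable mu g : bounded_borel g ->
  mu.-integrable setT (EFin \o (g : borel Xi -> R)).
Proof.
move=> [mg [M gM]]; apply: measurable_bounded_integrable => //.
  by rewrite ltey_eq fin_num_measure.
exists M; split; first exact: num_real.
by move=> x Mx xi _; exact: le_trans (gM xi) (ltW Mx).
Qed.

Lemma ler_norm_Rintegral_cst mu g (M : R) : bounded_borel g ->
    (forall xi, `|g xi| <= M) ->
  `|\int[mu]_xi (g : borel Xi -> R) xi| <= M * fine (mu setT).
Proof.
move=> bg gM; have ig := bounded_borel_integrable mu bg.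
apply: (le_trans (le_normr_Rintegral _ ig)) => //.
rewrite -Rintegral_cst//; apply: le_Rintegral => //.
  exact: (integrable_norm ig).
apply: measurable_bounded_integrable => //.
  by rewrite ltey_eq fin_num_measure.
exact: bounded_cst.
Qed.

End borel_functions.

Section charge_integral.
Context {R : realType} {Xi : ptopologicalType}.
Implicit Types (g h : Xi -> R) (nu : signed_measure R Xi).

(* [fpos nu] and [fneg nu] are [pos_part nu] and [neg_part nu] seen as finite
   measures. *)
Definition fpos nu : {finite_measure set (borel Xi) -> \bar R} :=
  jordan_pos (hahn_setsP nu).

Definition fneg nu : {finite_measure set (borel Xi) -> \bar R} :=
  jordan_neg (hahn_setsP nu).

Lemma charge_integralE nu g : charge_integral nu g =
  \int[fpos nu]_xi (g : borel Xi -> R) xi -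
  \int[fneg nu]_xi (g : borel Xi -> R) xi.
Proof. by []. Qed.

Lemma tv_normE nu :
  tv_norm nu = fine (fpos nu setT) + fine (fneg nu setT).
Proof. by rewrite /tv_norm/= -fineD ?fin_num_measure. Qed.

Lemma fposE nu (A : set (borel Xi)) : measurable A ->
  fpos nu A = nu (A `&` (hahn_sets nu).1).
Proof. by move=> mA; rewrite /fpos/= jordan_posE cjordan_posE /crestr0 mem_set. Qed.

Lemma fnegE nu (A : set (borel Xi)) : measurable A ->
  fneg nu A = (- nu (A `&` (hahn_sets nu).2))%E.
Proof.
by move=> mA; rewrite /fneg/= jordan_negE cjordan_negE /crestr0 mem_set.
Qed.

Lemma charge_pos_negE nu (A : set (borel Xi)) : measurable A ->
  nu A = (fpos nu A - fneg nu A)%E.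
Proof.
move=> mA; rewrite (jordan_decomp (hahn_setsP nu) mA) /cadd/=.
by rewrite cscaleN1.
Qed.

Lemma charge_integralD nu g h : bounded_borel g -> bounded_borel h ->
  charge_integral nu (g + h) = charge_integral nu g + charge_integral nu h.
Proof.
move=> bg bh; rewrite !charge_integralE !RintegralD//; last 4 first.
- exact: bounded_borel_integrable.
- exact: bounded_borel_integrable.
- exact: bounded_borel_integrable.
- exact: bounded_borel_integrable.
by rewrite opprD addrACA.
Qed.

Lemma charge_integralZ nu (c : R) g : bounded_borel g ->
  charge_integral nu (c *: g) = c * charge_integral nu g.
Proof.
move=> bg; rewrite !charge_integralE mulrBr.
by congr (_ - _); apply: RintegralZl => //; exact: bounded_borel_integrable.
Qed.

Lemma charge_integral0 nu : charge_integral nu (0 : Xi -> R) = 0.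
Proof.
by rewrite -(scale0r 0) charge_integralZ ?mul0r//; exact: bounded_borel0.
Qed.

Lemma charge_integral_sum nu n (c : 'I_n -> R) (u : 'I_n -> Xi -> R) :
  (forall i, bounded_borel (u i)) ->
  charge_integral nu (\sum_i c i *: u i) =
  \sum_i c i * charge_integral nu (u i).
Proof.
elim: n c u => [|n IH] c u bu; first by rewrite !big_ord0 charge_integral0.
rewrite !big_ord_recr/= charge_integralD ?charge_integralZ ?IH//.
  by apply: bounded_borel_sum => i; exact: bu.
exact: bounded_borelZ.
Qed.

Lemma ler_norm_charge_integral nu g (M : R) : bounded_borel g ->
  (forall xi, `|g xi| <= M) -> `|charge_integral nu g| <= M * tv_norm nu.
Proof.
move=> bg gM; rewrite charge_integralE tv_normE mulrDr.
apply: (le_trans (ler_normB _ _)).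
by rewrite lerD// ler_norm_Rintegral_cst.
Qed.

Lemma tv_norm_ge0 nu : 0 <= tv_norm nu.
Proof. by rewrite tv_normE addr_ge0// fine_ge0. Qed.

Lemma Rintegral_measure_add
    (m1 m2 : {finite_measure set (borel Xi) -> \bar R}) g :
  bounded_borel g ->
  \int[measure_add m1 m2]_xi (g : borel Xi -> R) xi =
  \int[m1]_xi (g : borel Xi -> R) xi + \int[m2]_xi (g : borel Xi -> R) xi.
Proof.
move=> bg; rewrite /Rintegral -fineD; last 2 first.
- by apply: integrable_fin_num => //; exact: bounded_borel_integrable.
- by apply: integrable_fin_num => //; exact: bounded_borel_integrable.
rewrite integral_measure_add//.
- exact: bounded_borel_integrable.
- exact: bounded_borel_integrable.
Qed.

(** The Hahn sets behind [charge_integral] are an opaque choice; this lemma computes the integral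
    from any splitting of [nu] into two finite measures. *)
Lemma charge_integral_diff nu
    (m1 m2 : {finite_measure set (borel Xi) -> \bar R}) g :
    (forall A, measurable A -> nu A = (m1 A - m2 A)%E) -> bounded_borel g ->
  charge_integral nu g =
  \int[m1]_xi (g : borel Xi -> R) xi - \int[m2]_xi (g : borel Xi -> R) xi.
Proof.
move=> nuE bg; rewrite charge_integralE.
(* Compare the nonnegative measures [fpos nu + m2 = fneg nu + m1]. *)
suff: \int[measure_add (fpos nu) m2]_xi (g : borel Xi -> R) xi =
      \int[measure_add (fneg nu) m1]_xi (g : borel Xi -> R) xi.
  by rewrite !Rintegral_measure_add//; lra.
congr fine; apply: eq_measure_integral => A mA _.
transitivity (fpos nu A + m2 A)%E; first exact: measure_addE.
transitivity (fneg nu A + m1 A)%E; last exact/esym/measure_addE.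
have := nuE _ mA; rewrite charge_pos_negE//.
rewrite -(@fineK _ (fpos nu A)) ?fin_num_measure//.
rewrite -(@fineK _ (fneg nu A)) ?fin_num_measure//.
rewrite -(@fineK _ (m1 A)) ?fin_num_measure//.
rewrite -(@fineK _ (m2 A)) ?fin_num_measure//.
by rewrite -!EFinB -!EFinD => -[?]; congr EFin; lra.
Qed.

End charge_integral.

(** * Atomic measures *)

Section atomic_charge.
Context {R : realType} {Xi : ptopologicalType}.
Implicit Types (g h : Xi -> R) (nu : signed_measure R Xi).

Section scaled_dirac.
Variables (c : {nonneg R}) (xi : borel Xi).

(** Named separately so that a finite-measure structure can be attached to it. *)
Definition scaled_dirac : set (borel Xi) -> \bar R := mscale c (\d_ xi).

HB.instance Definition _ := Measure.on scaled_dirac.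

Let scaled_dirac_fin : fin_num_fun scaled_dirac.
Proof. by move=> A mA; rewrite /scaled_dirac/= /mscale fin_numM// fin_num_measure. Qed.

HB.instance Definition _ := @Measure_isFinite.Build _ _ _
  scaled_dirac scaled_dirac_fin.

Lemma scaled_diracE (A : set (borel Xi)) :
  scaled_dirac A = (c%:num * \1_A xi)%:E.
Proof. by rewrite /scaled_dirac /mscale/= EFinM. Qed.

Lemma Rintegral_scaled_dirac g : bounded_borel g ->
  \int[scaled_dirac]_x (g : borel Xi -> R) x = c%:num * g xi.
Proof.
move=> [mg _].
have mG : measurable_fun setT (EFin \o (g : borel Xi -> R)) by exact/measurable_EFinP.
rewrite /Rintegral integralE.
rewrite !ge0_integral_mscale//; [|exact: measurable_funeneg|exact: measurable_funepos].
rewrite !integral_dirac//; [|exact: measurable_funeneg|exact: measurable_funepos].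
rewrite diracT !mul1e -muleBr//; last first.
  exact: add_def_funeposneg.
rewrite [X in fine (_ * X)%E](_ : _ = (g xi)%:E)//.
exact/esym/(congr1 (@^~ xi) (funeposneg (EFin \o (g : borel Xi -> R)))).
Qed.

End scaled_dirac.

Section finite_add.
Variables m1 m2 : {finite_measure set (borel Xi) -> \bar R}.

Definition finite_add : set (borel Xi) -> \bar R := measure_add m1 m2.

HB.instance Definition _ := Measure.on finite_add.

Let finite_add_fin : fin_num_fun finite_add.
Proof.
by move=> A mA; rewrite /finite_add/= measure_addE fin_numD !fin_num_measure.
Qed.

HB.instance Definition _ := @Measure_isFinite.Build _ _ _
  finite_add finite_add_fin.

End finite_add.

Lemma single_charge (a : R) (xi : Xi) : exists nu : signed_measure R Xi,
  (forall A, measurable A -> nu A = (a * \1_A xi)%:E) /\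
  (forall g, bounded_borel g -> charge_integral nu g = a * g xi).
Proof.
(* The positive and negative parts of [a] become the weights of two Dirac measures whose difference
   is [nu]. *)
have p0 : 0 <= Num.max a 0 by rewrite le_max lexx orbT.
have n0 : 0 <= Num.max (- a) 0 by rewrite le_max lexx orbT.
have aE : Num.max a 0 - Num.max (- a) 0 = a.
  by case: (leP a 0) => a0; case: (leP (- a) 0) => a0'; lra.
pose nu : signed_measure R Xi :=
  cscale a (charge_of_finite_measure (\d_ (xi : borel Xi))).
have nuE A : measurable A -> nu A = (a * \1_A xi)%:E by move=> mA; rewrite EFinM.
exists nu; split => // g bg.
rewrite (@charge_integral_diff _ _ nu (scaled_dirac (NngNum p0) xi)
  (scaled_dirac (NngNum n0) xi))//.
  by rewrite !Rintegral_scaled_dirac//= -mulrBl aE.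
move=> A mA; rewrite nuE// -{1}aE mulrBl EFinB.
by congr (_ - _)%E; exact/esym/scaled_diracE.
Qed.

(** The values on sets give the Radon property and the bound on the variation; the integral formula
    identifies the image under [Tk] as an atomic function. *)
Lemma atomic_charge K (a : 'I_K -> R) (xi : 'I_K -> Xi) :
  exists nu : signed_measure R Xi,
  (forall A, measurable A -> nu A = (\sum_j a j * \1_A (xi j))%:E) /\
  (forall g, bounded_borel g -> charge_integral nu g = \sum_j a j * g (xi j)).
Proof.
elim: K a xi => [|K IH] a xi.
  exists czero; split => [A mA|g bg]; rewrite big_ord0//.
  by rewrite (@charge_integral_diff _ _ _ mzero mzero) ?subrr// => A mA; rewrite sube0.
have [n1 [n1E i1]] := IH (a \o widen_ord (leqnSn K)) (xi \o widen_ord (leqnSn K)).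
have [n2 [n2E i2]] := single_charge (a ord_max) (xi ord_max).
pose nu : signed_measure R Xi := cadd n1 n2.
exists nu; split => [A mA|g bg]; rewrite big_ord_recr/=.
  by rewrite /nu/= /cadd n1E// n2E.
rewrite -i2// -(i1 g bg).
(* The sums of the Jordan parts of [n1] and [n2] split [nu], but in general are not its Jordan
   parts, hence the detour through [charge_integral_diff]. *)
transitivity (\int[measure_add (fpos n1) (fpos n2)]_x (g : borel Xi -> R) x -
  \int[measure_add (fneg n1) (fneg n2)]_x (g : borel Xi -> R) x); last first.
  by rewrite !Rintegral_measure_add// !charge_integralE; lra.
apply: (@charge_integral_diff _ _ nu (finite_add (fpos n1) (fpos n2))
  (finite_add (fneg n1) (fneg n2))) => // A mA.
transitivity ((fpos n1 A + fpos n2 A) - (fneg n1 A + fneg n2 A))%E; last first.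
  by congr (_ - _)%E; exact/esym/measure_addE.
rewrite /nu/= /cadd (charge_pos_negE n1)// (charge_pos_negE n2)//.
rewrite oppeD ?fin_num_adde_defl ?fin_num_measure//.
exact: addeACA.
Qed.

End atomic_charge.

Section atomic_charge_radon.
Context {R : realType} {Xi : ptopologicalType}.
Variables (K : nat) (a : 'I_K -> R) (xi : 'I_K -> Xi) (nu : signed_measure R Xi).
Hypothesis nuE : forall A : set (borel Xi),
  measurable A -> nu A = (\sum_j a j * \1_A (xi j))%:E.

Let mhahn : measurable (hahn_sets nu).1 /\ measurable (hahn_sets nu).2.
Proof. by have [[? _] [? _] _ _] := hahn_setsP nu. Qed.

(** Each atom lies in at most one of the two Hahn sets. Equality can fail, since the points [xi j]
    may coincide and their weights cancel. *)
Lemma atomic_charge_tv_norm : tv_norm nu <= \sum_j `|a j|.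
Proof.
have [mP mN] := mhahn.
rewrite tv_normE fposE// fnegE// !setTI !nuE//= -sumrN -big_split/=.
apply: ler_sum => j _.
have [_ _ _ PN0] := hahn_setsP nu.
rewrite !indicE; case: (boolP (xi j \in _)) => jP; case: (boolP (xi j \in _)) => jN /=.
- exfalso; move: jP jN; rewrite !inE => jP jN.
  by have : ((hahn_sets nu).1 `&` (hahn_sets nu).2) (xi j) by []; rewrite PN0.
- by rewrite mulr1 mulr0 subr0 ler_norm.
- by rewrite mulr0 mulr1 add0r -normrN ler_norm.
- by rewrite !mulr0 subr0.
Qed.

Lemma compact_borel_measurable (C : set Xi) : hausdorff_space Xi -> compact C ->
  measurable (C : set (borel Xi)).
Proof.
move=> hXi cC; rewrite -(setCK C); apply: measurableC.
apply: sub_sigma_algebra; apply: closed_openC; exact: compact_closed.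
Qed.

(** The finitely many atoms lying in [A] form a compact set, and [nu] vanishes on every Borel subset
    of the rest of [A]. *)
Lemma atomic_charge_radon : hausdorff_space Xi -> radon nu.
Proof.
move=> hXi A mA e e0; pose C := A `&` range xi.
have cC : compact C.
  apply: finite_compact; apply: sub_finite_set (@subIsetr _ _ _) _.
  exact: finite_image.
have mC := compact_borel_measurable hXi cC.
have [mP mN] := mhahn.
have z B : measurable B -> nu ((A `\` C) `&` B) = 0.
  move=> mB; rewrite nuE; last by apply: measurableI => //; exact: measurableD.
  rewrite big1// => j _; rewrite indicE memNset ?mulr0// => -[[Aj nCj] _].
  by apply: nCj; split => //; exists j.
exists C; split => //; first exact: subIsetl.
have mAC : measurable (A `\` C) by exact: measurableD.
apply: (@le_lt_trans _ _ (fpos nu (A `\` C) + fneg nu (A `\` C))%E) => //.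
by rewrite fposE// fnegE// !z// oppe0 adde0 lte_fin.
Qed.

End atomic_charge_radon.

(** * Functions vanishing at infinity *)

Section vanishing_at_infinity.
Context {R : realType} {Xi : topologicalType} {V : normedModType R}.
Variable g : Xi -> V.
Hypothesis cg : continuous g.
Hypothesis g_vanish : forall e : R, 0 < e -> compact [set xi | e <= `|g xi|].

Lemma closed_normr_ge (e : R) : closed [set xi | e <= `|g xi|].
Proof.
apply: (@preimage_closed _ _ (fun xi => `|g xi|) [set r | e <= r]).
  by move=> xi _; apply: continuous_comp; [exact: cg | exact: norm_continuous].
exact: closed_ge.
Qed.

(** Vanishing at infinity is exactly what continuity at the added point [None] asks for. *)
Lemma vanishing_oapp_continuous :
  continuous (oapp g 0 : one_point_compactification Xi -> V).
Proof.
move=> [xi|] U /=; first exact: cg.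
move=> /nbhs_ballP[e e0 eU].
exists [set xi | e <= `|g xi|]; first by split; [exact: g_vanish | exact: closed_normr_ge].
move=> _ [[xi /= xie <-]|->] /=; apply: eU.
  by rewrite -ball_normE/= sub0r normrN ltNge; apply/negP.
exact: ballxx.
Qed.

Lemma vanishing_range_compact : compact (range g `|` [set 0]).
Proof.
have -> : range g `|` [set 0] =
    (oapp g 0 : one_point_compactification Xi -> V) @` setT.
  apply/seteqP; split=> [v [[xi _ <-]|->]|v [[xi|] _ <-]].
  - by exists (Some xi).
  - by exists None.
  - by left; exists xi.
  - by right.
apply: continuous_compact; last exact: one_point_compactification_compact.
exact/continuous_subspaceT/vanishing_oapp_continuous.
Qed.

End vanishing_at_infinity.

Section C0.
Context {R : realType} {Xi : ptopologicalType}.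

Lemma C0_bounded (g : Xi -> R) : C0 g -> exists M, forall xi, `|g xi| <= M.
Proof.
move=> [cg vg].
have [M [_ gM]] := compact_bounded (vanishing_range_compact (V := R^o) cg vg).
exists (M + 1) => xi; apply: (gM (M + 1)); first by rewrite ltrDl.
by left; exists xi.
Qed.

Lemma C0_bounded_borel (g : Xi -> R) : C0 g -> bounded_borel g.
Proof.
move=> g0; split; last exact: C0_bounded.
by apply: continuous_borel_measurable; case: g0.
Qed.

Lemma le_sup_norm (g : Xi -> R) (xi : Xi) :
  (exists M, forall xi, `|g xi| <= M) -> `|g xi| <= sup_norm g.
Proof.
move=> [M gM]; apply: ub_le_sup; last by exists xi.
by exists M => _ [z _ <-].
Qed.

Lemma opc_restr_C0 (f : one_point_compactification Xi -> R) :
  continuous f -> f None = 0 -> C0 (f \o Some).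
Proof.
move=> cf f0; split.
  move=> xi; apply: continuous_comp; last exact: cf.
  exact: one_point_compactification_some_continuous.
move=> e e0.
have : nbhs (None : one_point_compactification Xi) [set y | `|f y| < e].
  apply: (cf None [set r | `|r| < e]); rewrite /= f0.
  by apply/nbhs_ballP; exists e => // r; rewrite -ball_normE/= sub0r normrN.
move=> [C [cC _] Ce].
apply: (@subclosed_compact _ _ C) => //.
  apply: closed_normr_ge => xi; apply: continuous_comp; last exact: cf.
  exact: one_point_compactification_some_continuous.
move=> xi /= exi; apply: contrapT => nC.
have : `|f (Some xi)| < e by apply: (Ce (Some xi)); left; exists xi.
by rewrite ltNge exi.
Qed.

Hypothesis Xi_lc : locally_compact [set: Xi].
Hypothesis Xi_h : hausdorff_space Xi.

(** Urysohn's lemma in the one-point compactification, which is compact Hausdorff and so normal.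
    Adjoining [None] to [B] forces the function to vanish at infinity. *)
Lemma C0_urysohn1 (A B : set Xi) : compact A -> compact B -> A `&` B = set0 ->
  exists g : Xi -> R, [/\ C0 g, forall xi, 0 <= g xi <= 1,
    forall xi, A xi -> g xi = 1 & forall xi, B xi -> g xi = 0].
Proof.
move=> cA cB AB0.
pose opc := one_point_compactification Xi.
have oh : hausdorff_space opc by exact: one_point_compactification_hausdorff.
have cSome (C : set Xi) : compact C -> compact ((Some : Xi -> opc) @` C).
  apply: continuous_compact; apply: continuous_subspaceT.
  exact: one_point_compactification_some_continuous.
have on := compact_normal oh one_point_compactification_compact.
have : uniform_separator
    (((Some : Xi -> opc) @` B) `|` [set None]) ((Some : Xi -> opc) @` A).
  apply: ((normal_separatorP (R := R)).1 on).
  - apply: compact_closed => //; apply: compactU; [exact: cSome | exact: compact_set1].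
  - by apply: compact_closed => //; exact: cSome.
  - apply/seteqP; split => // _ [/= [[xi Bxi <-]|->] [z Az]] // [zxi].
    have : (A `&` B) xi by rewrite -zxi; split => //; rewrite zxi.
    by rewrite AB0.
move=> /uniform_separatorP => /(_ R)[f [cf f01 fB fA]].
have f0 := imsub1 fB; have f1 := imsub1 fA.
exists (f \o Some); split => /=.
- by apply: opc_restr_C0 => //; apply: f0; right.
- by move=> xi; have := f01 (f (Some xi)); rewrite /= in_itv/=; apply; exists (Some xi).
- by move=> xi Axi; apply: f1; exists xi.
- by move=> xi Bxi; apply: f0; left; exists xi.
Qed.

Lemma C0D (g h : Xi -> R) : C0 g -> C0 h -> C0 (g + h).
Proof.
move=> [cg vg] [ch vh]; have cgh : continuous (g + h).
  by move=> xi; apply: cvgD; [exact: cg | exact: ch].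
split => // e e0.
have e2 : 0 < e / 2 by rewrite divr_gt0.
have cU := compactU (vg _ e2) (vh _ e2).
apply: (subclosed_compact _ cU); first exact: closed_normr_ge.
move=> xi /= egh; have [?|ge] := leP (e / 2) `|g xi|; first by left.
right; rewrite /= leNgt; apply/negP => he.
have : `|g xi + h xi| < e.
  by apply: (le_lt_trans (ler_normD _ _)); lra.
by rewrite ltNge egh.
Qed.

Lemma C0N (g : Xi -> R) : C0 g -> C0 (- g).
Proof.
move=> [cg vg]; split; first by move=> xi; apply: cvgN; exact: cg.
move=> e e0; rewrite (_ : mkset _ = [set xi | e <= `|g xi|]); first exact: vg.
by apply/funext => xi /=; rewrite normrN.
Qed.

Lemma C0_urysohn (A B : set Xi) : compact A -> compact B -> A `&` B = set0 ->
  exists g : Xi -> R, [/\ C0 g, forall xi, `|g xi| <= 1,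
    forall xi, A xi -> g xi = 1 & forall xi, B xi -> g xi = -1].
Proof.
move=> cA cB AB0.
have [g [g0 g01 gA gB]] := C0_urysohn1 cA cB AB0.
have BA0 : B `&` A = set0 by rewrite setIC.
have [h [h0 h01 hB hA]] := C0_urysohn1 cB cA BA0.
exists (g - h); split.
- by apply: C0D => //; exact: C0N.
- move=> xi; have /andP[? ?] := g01 xi; have /andP[? ?] := h01 xi.
  by rewrite ler_norml; apply/andP; split; rewrite !fctE; lra.
- by move=> xi Axi; rewrite !fctE gA// hA// subr0.
- by move=> xi Bxi; rewrite !fctE gB// hB// sub0r.
Qed.

End C0.

(** * Total variation as a dual norm *)

Section total_variation_dual.
Context {R : realType} {Xi : ptopologicalType}.
Implicit Types (g h : Xi -> R) (nu : signed_measure R Xi).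

Lemma Rintegral_ge_near_cst1 (m : {finite_measure set (borel Xi) -> \bar R}) g
    (C : set (borel Xi)) (e : R) :
  bounded_borel g -> (forall xi, `|g xi| <= 1) -> measurable C ->
  (forall xi, C xi -> g xi = 1) -> (m (~` C) <= e%:E)%E ->
  fine (m setT) - 2 * e <= \int[m]_xi (g : borel Xi -> R) xi.
Proof.
move=> bg g1 mC gC mCe.
have mC' : measurable (~` C) by exact: measurableC.
have b1 : bounded_borel (cst 1 : Xi -> R).
  by split; [exact: measurable_cst|exists 1 => xi; rewrite normr1].
have bI : bounded_borel (\1_(~` C) : Xi -> R).
  split; first exact: (measurable_indic mC').
  by exists 1 => xi; rewrite indicE; case: (_ \in _); rewrite ?normr1 ?normr0.
have bIZ := bounded_borelZ 2 bI.
have IE : \int[m]_xi (\1_(~` C) : borel Xi -> R) xi = fine (m (~` C)).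
  by rewrite /Rintegral integral_indic// setIT.
have -> : fine (m setT) = \int[m]_(xi in [set: borel Xi]) 1.
  by rewrite Rintegral_cst// mul1r.
apply: (@le_trans _ _ (\int[m]_xi (1 - 2 * (\1_(~` C) : borel Xi -> R) xi))).
  rewrite RintegralB//; [|exact: (bounded_borel_integrable m b1)|
    exact: (bounded_borel_integrable m bIZ)].
  rewrite RintegralZl//; last exact: (bounded_borel_integrable m bI).
  rewrite IE lerB// ler_pM2l//.
  by rewrite -lee_fin fineK// fin_num_measure.
apply: le_Rintegral => //.
- have := bounded_borelD b1 (bounded_borelZ (-1) bIZ).
  move=> /(bounded_borel_integrable m); congr (m.-integrable _ _).
  by apply/funext => xi; rewrite /= !fctE scaleN1r.
- exact: bounded_borel_integrable.
move=> xi _; rewrite indicE; have := g1 xi; rewrite ler_norml => /andP[gl gu].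
case: (boolP (xi \in _)) => /=.
  by move=> _; lra.
by rewrite notin_setE /= => /contrapT /gC ->; lra.
Qed.

Lemma tv_norm_approx nu (e : R) : locally_compact [set: Xi] ->
  hausdorff_space Xi -> radon nu -> 0 < e ->
  exists g, [/\ C0 g, forall xi, `|g xi| <= 1 &
    tv_norm nu - e <= charge_integral nu g].
Proof.
move=> lc hX rnu e0.
(* Each of the two Jordan parts will lose at most twice the mass missed by its compact set, so
   [e / 4] gives a total loss of [e]. *)
have e4 : 0 < e / 4 by rewrite divr_gt0.
have [[mP pP] [mN nN] PNT PN0] := hahn_setsP nu.
set P := (hahn_sets nu).1 in mP pP PNT PN0 *.
set N := (hahn_sets nu).2 in mN nN PNT PN0 *.
have [C1 [cC1 C1P C1e]] := rnu _ mP _ e4.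
have [C2 [cC2 C2N C2e]] := rnu _ mN _ e4.
have C12 : C1 `&` C2 = set0.
  by apply/seteqP; split => // xi [/C1P ? /C2N ?]; rewrite -PN0.
have [g [g0 g1 gC1 gC2]] := C0_urysohn (R := R) lc hX cC1 cC2 C12.
exists g; split => //.
have bg := C0_bounded_borel g0.
have mC1 := compact_borel_measurable hX cC1.
have mC2 := compact_borel_measurable hX cC2.
have pe : (fpos nu (~` C1) <= (e / 4)%:E)%E.
  apply: (le_trans _ (ltW C1e)).
  apply: (@le_trans _ _ (fpos nu (P `\` C1) + fneg nu (P `\` C1))%E); last exact: lexx.
  apply: (@le_trans _ _ (fpos nu (P `\` C1))); last exact: leeDl.
  rewrite !fposE//; [|exact: measurableD|exact: measurableC].
  by rewrite -/P setDE setIAC setIid setIC.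
have ne : (fneg nu (~` C2) <= (e / 4)%:E)%E.
  apply: (le_trans _ (ltW C2e)).
  apply: (@le_trans _ _ (fpos nu (N `\` C2) + fneg nu (N `\` C2))%E); last exact: lexx.
  apply: (@le_trans _ _ (fneg nu (N `\` C2))); last exact: leeDr.
  rewrite !fnegE//; [|exact: measurableD|exact: measurableC].
  by rewrite -/N setDE setIAC setIid setIC.
have hp := Rintegral_ge_near_cst1 bg g1 mC1 gC1 pe.
have hn : fine (fneg nu setT) - 2 * (e / 4) <=
    - \int[fneg nu]_xi (g : borel Xi -> R) xi.
  rewrite -[leRHS]mulN1r -RintegralZl//; last exact: bounded_borel_integrable.
  apply: (@Rintegral_ge_near_cst1 (fneg nu) ((-1) *: g) C2) => //.
  - exact: bounded_borelZ.
  - by move=> xi; rewrite scaleN1r normrN.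
  - by move=> xi /gC2; rewrite !fctE => ->; rewrite scaleN1r opprK.
by rewrite tv_normE charge_integralE; lra.
Qed.

End total_variation_dual.

(** * Independence of the I-RKBS norm from the representing measure *)

Section irkbs_norm.
Context {R : realType} {X : Type} {Xi : ptopologicalType}.
Variable kappa : X -> Xi -> R.
Hypothesis Xi_lc : locally_compact [set: Xi].
Hypothesis Xi_h : hausdorff_space Xi.
Hypothesis kernel : irkbs_kernel kappa.

Lemma kernel_bounded_borel x : bounded_borel (kappa x).
Proof. by apply: C0_bounded_borel; case: kernel => + _; apply. Qed.

(** The two integrals agree on kernel functions, by linearity on their span, and by density on all
    of [C0]. *)
Lemma Tk_eq_charge_integral (nu nu' : signed_measure R Xi) (g : Xi -> R) :
  Tk kappa nu = Tk kappa nu' -> C0 g ->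
  charge_integral nu g = charge_integral nu' g.
Proof.
move=> Tnu g0; have [_ dk] := kernel.
apply/eqP; rewrite -subr_eq0 -normr_le0; apply/ler_addgt0Pl => e e0; rewrite addr0.
(* The summand 1 keeps the divisor of [e / t] positive when both norms vanish. *)
pose t := tv_norm nu + tv_norm nu' + 1.
have t0 : 0 < t by rewrite ltr_wpDl// addr_ge0// tv_norm_ge0.
have [h [n [c [u [uk ->]]]] gh] := dk g g0 _ (divr_gt0 e0 t0).
set h' := \sum_(i < n) _ in gh *.
have bu i : bounded_borel (u i).
  by have [x _ <-] := uk i; exact: kernel_bounded_borel.
have bh : bounded_borel h' by exact: bounded_borel_sum.
have bg := C0_bounded_borel g0.
have hE : charge_integral nu h' = charge_integral nu' h'.
  rewrite !charge_integral_sum//; apply: eq_bigr => i _; congr (_ * _).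
  by have [x _ <-] := uk i; exact: (congr1 (@^~ x) Tnu).
have bNh := bounded_borelZ (-1) bh.
have bd : bounded_borel (g - h').
  by rewrite -scaleN1r; exact: bounded_borelD.
have dle xi : `|(g - h') xi| <= e / t.
  by apply: le_trans (ltW gh); apply: le_sup_norm; case: bd.
have dE (mu : signed_measure R Xi) :
    charge_integral mu (g - h') = charge_integral mu g - charge_integral mu h'.
  by rewrite -scaleN1r charge_integralD// charge_integralZ// mulN1r.
have d1 := ler_norm_charge_integral nu bd dle.
have d2 := ler_norm_charge_integral nu' bd dle.
have -> : charge_integral nu g - charge_integral nu' g =
    charge_integral nu (g - h') - charge_integral nu' (g - h').
  by rewrite !dE hE; lra.
apply: (le_trans (ler_normB _ _)); apply: (le_trans (lerD d1 d2)).
rewrite -mulrDr -mulrA -[leRHS]mulr1 ler_pM2l// mulrC ler_pdivrMr// mul1r.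
by rewrite /t lerDl.
Qed.

(** A function of [C0] bounded by 1 nearly attains the norm of [nu], and [nu'] has the same integral
    against it. *)
Lemma Tk_eq_tv_norm_le (nu nu' : signed_measure R Xi) :
  radon nu -> Tk kappa nu = Tk kappa nu' -> tv_norm nu <= tv_norm nu'.
Proof.
move=> rnu Tnu; apply/ler_addgt0Pr => e e0.
have [g [g0 g1 ge]] := tv_norm_approx Xi_lc Xi_h rnu e0.
rewrite -lerBlDr (le_trans ge)// (Tk_eq_charge_integral Tnu g0).
apply: (le_trans (ler_norm _)); rewrite -[leRHS]mul1r.
by apply: ler_norm_charge_integral => //; exact: C0_bounded_borel.
Qed.

Lemma irkbs_normE (nu : signed_measure R Xi) :
  radon nu -> irkbs_norm kappa (Tk kappa nu) = tv_norm nu.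
Proof.
move=> rnu; rewrite /irkbs_norm.
set A := (X in get X).
(* [A] is inhabited, so [get] returns the norm of some Radon representative and not a default
   value. *)
have : A (get A) by apply: getPex; exists (tv_norm nu); exists nu.
move=> [nu' [rnu' Tnu'] <-].
by apply/eqP; rewrite eq_le !Tk_eq_tv_norm_le.
Qed.

Lemma atomic_irkbs K (a : 'I_K -> R) (xi : 'I_K -> Xi) :
  irkbs kappa (atomic kappa (a, xi)) /\
  irkbs_norm kappa (atomic kappa (a, xi)) <= \sum_j `|a j|.
Proof.
have [nu [nuE inu]] := atomic_charge a xi.
have rnu : radon nu by exact: (atomic_charge_radon nuE Xi_h).
have <- : Tk kappa nu = atomic kappa (a, xi).
  by apply/funext => x; rewrite /Tk inu//; exact: kernel_bounded_borel.
split; first by exists nu.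
by rewrite irkbs_normE//; exact: (atomic_charge_tv_norm nuE).
Qed.

End irkbs_norm.

(** * Finite-dimensional convexity and compactness *)

Section ord_rcons.
Variables (T : Type) (K : nat) (f : 'I_K -> T) (y : T).

Definition ord_rcons (j : 'I_K.+1) : T := oapp f y (unlift ord_max j).

Lemma ord_rcons_widen (i : 'I_K) : ord_rcons (widen_ord (leqnSn K) i) = f i.
Proof.
rewrite /ord_rcons (_ : widen_ord _ i = lift ord_max i) ?liftK//.
by apply: val_inj; rewrite /= /bump leqNgt ltn_ord.
Qed.

Lemma ord_rcons_max : ord_rcons ord_max = y.
Proof. by rewrite /ord_rcons unlift_none. Qed.

End ord_rcons.

(** * Reduction of the number of atoms *)

Section caratheodory.
Context {R : realFieldType} {N : nat}.

(** The coefficients are a nonzero vector of the left kernel of the matrix with rows [u j], whose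
    rank is at most [N]. *)
Lemma linear_dependence K (u : 'I_K -> 'rV[R]_N) : (N < K)%N ->
  exists2 c : 'I_K -> R, \sum_j c j *: u j = 0 & exists j, c j != 0.
Proof.
move=> NK; pose U := \matrix_j u j.
have : kermx U != 0.
  by rewrite kermx_eq0 /row_free neq_ltn (leq_ltn_trans (rank_leq_col _) NK).
move=> /rowV0Pn[c /sub_kermxP cU c0].
exists (fun j => c 0 j).
  rewrite -[RHS]cU mulmx_sum_row; apply: eq_bigr => j _.
  by rewrite rowK.
by have /rV0Pn := c0.
Qed.

(* The sign of the dependence is chosen so that subtracting a multiple of it
   does not increase the total weight. *)
Lemma nonneg_linear_dependence K (u : 'I_K -> 'rV[R]_N) : (N < K)%N ->
  exists c : 'I_K -> R, [/\ \sum_j c j *: u j = 0, 0 <= \sum_j c j &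
    exists j, 0 < c j].
Proof.
move=> NK; have [c cu [j cj]] := linear_dependence u NK.
wlog c0 : c cu cj / 0 <= \sum_j c j.
  move=> W; have [c0|c0] := leP 0 (\sum_j c j); first exact: (W c).
  apply: (W (fun j => - c j)).
  - by under eq_bigr do rewrite scaleNr; rewrite sumrN cu oppr0.
  - by rewrite oppr_eq0.
  - by rewrite sumrN oppr_ge0 ltW.
exists c; split => //; apply: contrapT => nc.
have cle k : c k <= 0 by rewrite leNgt; apply/negP => ck; apply: nc; exists k.
have : \sum_j c j < 0.
  rewrite (bigD1 j)//= -[ltRHS]addr0 ltr_leD//; first by rewrite lt_neqAle cj cle.
  by rewrite sumr_le0.
by rewrite ltNge c0.
Qed.

(** With the signs moved into the vectors, the weights are the nonnegative [|a j|]. They are moved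
    along a dependence of nonnegative sum until the first of them vanishes. *)
Lemma drop_atom (T : Type) (phi : T -> 'rV[R]_N) K (a : 'I_K.+1 -> R)
    (xi : 'I_K.+1 -> T) : (N <= K)%N ->
  exists (b : 'I_K -> R) (eta : 'I_K -> T),
    \sum_j b j *: phi (eta j) = \sum_j a j *: phi (xi j) /\
    \sum_j `|b j| <= \sum_j `|a j|.
Proof.
move=> NK.
(* The sign is 1 at a zero weight, so that [s j * s j = 1] always holds. *)
pose s j : R := if 0 <= a j then 1 else -1.
have ss j : s j * s j = 1.
  by rewrite /s; case: ifP => _; rewrite ?mulr1// mulrNN mulr1.
have sa j : a j = s j * `|a j|.
  rewrite /s; case: (leP 0 (a j)) => aj; first by rewrite mul1r ger0_norm.
  by rewrite ltr0_norm// mulN1r opprK.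
have s1 j : `|s j| = 1 by rewrite /s; case: ifP; rewrite ?normrN normr1.
have [c [cu c0 [j1 cj1]]] :=
  nonneg_linear_dependence (fun j => s j *: phi (xi j)) (NK : (N < K.+1)%N).
pose j0 := [arg min_(j < j1 | 0 < c j) (`|a j| / c j)]%O.
have [cj0 j0min] : 0 < c j0 /\ forall j, 0 < c j -> `|a j0| / c j0 <= `|a j| / c j.
  by rewrite /j0; case: arg_minP.
(* The least ratio: subtracting [t * c] annihilates the weight at [j0] and
   keeps all others nonnegative. *)
pose t := `|a j0| / c j0.
have t0 : 0 <= t by rewrite divr_ge0// ltW.
pose d j := `|a j| - t * c j.
have d0 j : 0 <= d j.
  rewrite /d subr_ge0; have [cj|cj] := ltP 0 (c j).
    by rewrite -ler_pdivlMr//; exact: j0min.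
  by rewrite (le_trans _ (normr_ge0 _))// mulr_ge0_le0.
have dj0 : d j0 = 0 by rewrite /d /t divfK ?subrr// gt_eqF.
exists (fun j => s (lift j0 j) * d (lift j0 j)).
exists (fun j => xi (lift j0 j)).
have sumE (V : zmodType) (F : 'I_K.+1 -> V) : F j0 = 0 ->
    \sum_j F (lift j0 j) = \sum_j F j.
  by move=> F0; rewrite [RHS](bigD1_ord j0)//= F0 add0r.
split.
  rewrite (sumE _ (fun j => (s j * d j) *: phi (xi j))); last by rewrite dj0 mulr0 scale0r.
  under eq_bigr => j _ do rewrite /d mulrBr -sa scalerBl mulrCA (mulrC (s j))
    -(scalerA t) -(scalerA (c j)).
  rewrite sumrB -scaler_sumr.
  by rewrite cu scaler0 subr0.
rewrite (sumE _ (fun j => `|s j * d j|)); last by rewrite dj0 mulr0 normr0.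
under eq_bigr => j _ do rewrite normrM s1 mul1r ger0_norm// /d.
by rewrite sumrB -mulr_sumr gerBl mulr_ge0.
Qed.

End caratheodory.

(** * Attained minima on compact sets *)

Section compact_minimum.
Context {R : realType} {T : topologicalType}.

(** If the infimum [m] is not attained, near each point [F] exceeds some real level above [m];
    compactness yields one level for all of [D], contradicting the choice of [m]. *)
Lemma lower_semicontinuous_min (D : set T) (F : T -> \bar R) :
  compact D -> D !=set0 ->
  (forall t, D t -> (0 <= F t)%E) -> lower_semicontinuous F ->
  exists2 t, D t & forall s, D s -> (F t <= F s)%E.
Proof.
move=> cD [t0 Dt0] F0 lF; apply: contrapT => nmin.
pose m := ereal_inf (F @` D).
have mF t : D t -> (m < F t)%E.
  move=> Dt; rewrite lt_neqAle ereal_inf_lbound ?andbT; last by exists t.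
  apply/negP => /eqP mE; apply: nmin; exists t => // s Ds.
  by rewrite -mE; apply: ereal_inf_lbound; exists s.
have m0 : (0 <= m)%E.
  by apply: le_ereal_inf_tmp => _ [t Dt <-]; exact: F0.
(* Unattainedness makes [m < F t0] strict, which excludes an infinite [m]. *)
have mfin : m \is a fin_num.
  by rewrite ge0_fin_numE//; exact: lt_le_trans (mF _ Dt0) (leey _).
have W : \forall b \near (fine m)^'+, D `<=` [set t | (b%:E < F t)%E].
  apply: ((compact_near_coveringP D).1 cD) => t Dt.
  have [a] : exists a : R, (m < a%:E < F t)%E.
    have := mF _ Dt; rewrite -(fineK mfin).
    case: (F t) => [r|_|//]; last by exists (fine m + 1); rewrite lte_fin ltrDl ltr01 ltry.
    by rewrite lte_fin => mr; exists ((fine m + r) / 2); rewrite !lte_fin midf_lt// midf_lt.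
  move=> /andP[ma /lF[V tV VF]].
  have ma' : fine m < a by rewrite -lte_fin fineK.
  exists (V, [set b | b < a]).
    by split => //=; exact: nbhs_right_lt.
  by move=> [s b] /= [Vs ba]; apply: lt_trans (VF _ Vs); rewrite lte_fin.
have [b [mb bF]] : exists b, fine m < b /\ forall t, D t -> (b%:E < F t)%E.
  have [b [? ?]] := filter_ex (filterI W (nbhs_right_gt (fine m))).
  by exists b.
have : (b%:E <= m)%E by apply: le_ereal_inf_tmp => _ [t Dt <-]; exact/ltW/bF.
by rewrite leNgt -(fineK mfin) lte_fin mb.
Qed.

End compact_minimum.

(** * Compactness of the set of atomic sums *)

Section atoms_compact.
Context {R : realType} {V : normedModType R}.
Variables (A : set V) (B : R).
Hypothesis cA : compact A.

(** The second coordinate keeps the total weight, so that the objective becomes a function on this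
    set. Bounding the weights one by one makes the set a sum of [K] copies of one compact set. *)
Definition atoms K : set (V * R) :=
  [set p | exists (a : 'I_K -> R) (u : 'I_K -> V),
     [/\ forall j, `|a j| <= B, forall j, A (u j) &
       p = (\sum_j a j *: u j, \sum_j `|a j|)]].

Lemma atom1_compact : compact [set p : V * R | exists (a : R) (u : V),
  [/\ `|a| <= B, A u & p = (a *: u, `|a|)]].
Proof.
have cI : compact `[(- B), B] by exact: segment_compact.
pose f (q : R^o * V) : V * R := (q.1 *: q.2, `|q.1|).
have cf : continuous f.
  move=> q; apply: (@cvg_pair _ _ _ (nbhs q) (nbhs (q.1 *: q.2)) (nbhs `|q.1|)
    _ _ _ (fun q => q.1 *: q.2) (fun q => `|q.1|)).
    exact: scale_continuous.
  by apply: continuous_comp; [exact: cvg_fst|exact: norm_continuous].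
suff -> : [set p : V * R | exists (a : R) (u : V),
    [/\ `|a| <= B, A u & p = (a *: u, `|a|)]] = f @` (`[(- B), B] `*` A).
  apply: continuous_compact; first exact: continuous_subspaceT.
  exact: compact_setX.
apply/seteqP; split => [p [a [u [aB Au ->]]]|_ [[a u] [/= aB Au] <-]].
  by exists (a, u) => //; split => //=; rewrite in_itv/= -ler_norml.
by exists a, u; split => //; move: aB; rewrite in_itv/= -ler_norml.
Qed.

Lemma atoms_compact K : compact (atoms K).
Proof.
elim: K => [|K IH].
  rewrite (_ : atoms 0 = [set 0]); first exact: compact_set1.
  apply/seteqP; split => [p [a [u [_ _ ->]]]|_ ->] /=; first by rewrite !big_ord0.
  by exists (fun=> 0), (fun=> 0); split; [case|case|rewrite !big_ord0].
have := compact_setX IH atom1_compact.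
have cadd : continuous (fun q : (V * R) * (V * R) => q.1 + q.2).
  by move=> q; exact: add_continuous.
move=> /(continuous_compact (continuous_subspaceT cadd)).
congr compact; apply/seteqP; split.
  move=> _ [[_ _] [/= [a [u [aB Au ->]]] [b [v [bB Av ->]]]] <-] /=.
  exists (ord_rcons a b), (ord_rcons u v); split.
  - by move=> j; rewrite /ord_rcons; case: (unlift _ _) => [i|] /=.
  - by move=> j; rewrite /ord_rcons; case: (unlift _ _) => [i|] /=.
  rewrite !big_ord_recr/= !ord_rcons_max; congr (_ + _, _ + _);
    by apply: eq_bigr => i _; rewrite !ord_rcons_widen.
move=> p [a [u [aB Au ->]]].
exists ((\sum_(j < K) a (widen_ord (leqnSn K) j) *: u (widen_ord (leqnSn K) j),
  \sum_(j < K) `|a (widen_ord (leqnSn K) j)|), (a ord_max *: u ord_max, `|a ord_max|)).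
  split.
    by exists (fun j => a (widen_ord (leqnSn K) j)), (fun j => u (widen_ord (leqnSn K) j)).
  by exists (a ord_max), (u ord_max).
by rewrite !big_ord_recr.
Qed.

End atoms_compact.

(** * Euclidean inner product and nearest points *)

Section dot.
Context {R : realType} {N : nat}.
Implicit Types u v w : 'rV[R]_N.

(** The norm of ['rV[R]_N] is the maximum norm, so the nearest-point argument needs this separate
    Euclidean structure. *)
Definition dot u v : R := \sum_i u 0 i * v 0 i.

Lemma dotDr u v w : dot u (v + w) = dot u v + dot u w.
Proof. by rewrite -big_split; apply: eq_bigr => i _; rewrite mxE mulrDr. Qed.

Lemma dotZr u (c : R) v : dot u (c *: v) = c * dot u v.
Proof. by rewrite mulr_sumr; apply: eq_bigr => i _; rewrite mxE mulrCA. Qed.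

Lemma dotC u v : dot u v = dot v u.
Proof. by apply: eq_bigr => i _; rewrite mulrC. Qed.

Lemma dotBr u v w : dot u (v - w) = dot u v - dot u w.
Proof. by rewrite dotDr -scaleN1r dotZr mulN1r. Qed.

Lemma dot_ge0 u : 0 <= dot u u.
Proof. by apply: sumr_ge0 => i _; rewrite -expr2 sqr_ge0. Qed.

Lemma dot_le0 u : dot u u <= 0 -> u = 0.
Proof.
move=> u0; apply/rowP => i; rewrite mxE; apply/eqP; rewrite -sqrf_eq0 -normr_le0.
rewrite ger0_norm ?sqr_ge0//; apply: le_trans u0.
by rewrite /dot (bigD1 i)//= expr2 lerDl sumr_ge0// => j _; rewrite -expr2 sqr_ge0.
Qed.

Lemma dot_sub_continuous v : continuous (fun u => dot (v - u) (v - u)).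
Proof.
have c i : continuous (fun u : 'rV[R]_N => (v - u) 0 i).
  rewrite (_ : (fun _ => _) = fun u : 'rV[R]_N => v 0 i - u 0 i); last first.
    by apply/funext => w; rewrite !mxE.
  move=> u; apply: (@continuousB R R^o _ (fun=> v 0 i)); first exact: cst_continuous.
  exact: (@coord_continuous R 1 N 0 i u).
rewrite /dot; apply: continuous_big => [|i _ u].
  by move=> p; exact: add_continuous.
exact: (continuousM (c i u) (c i u)).
Qed.

(* First-order optimality of the nearest point [w] in the direction [z - w]. *)
Lemma nearest_point_dot_le0 (D : set 'rV[R]_N) v w z :
  (forall y, D y -> dot (v - w) (v - w) <= dot (v - y) (v - y)) ->
  (forall e, 0 < e -> e <= 1 -> D ((1 - e) *: w + e *: z)) ->
  dot (v - w) z <= dot (v - w) w.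
Proof.
move=> wmin seg; rewrite -subr_le0 -dotBr; apply/ler_addgt0Pr => d d0; rewrite add0r.
set p := v - w; set y := z - w.
have [y0|y0] := eqVneq (dot y y) 0.
  have -> : y = 0 by apply: dot_le0; rewrite y0.
  by rewrite -(scale0r p) dotZr mul0r ltW.
have yp : 0 < dot y y by rewrite lt_neqAle eq_sym y0 dot_ge0.
(* Expanding the minimality of [w] against the point at parameter [e] gives
   [2 * dot p y <= e * dot y y], and this [e] makes the right side at most [d]. *)
pose e := Num.min 1 (d / dot y y).
have e0 : 0 < e by rewrite lt_min ltr01 divr_gt0.
have e1 : e <= 1 by rewrite ge_min lexx.
have ed : e * dot y y <= d by rewrite -ler_pdivlMr// ge_min lexx orbT.
have := wmin _ (seg _ e0 e1).
have -> : v - ((1 - e) *: w + e *: z) = p - e *: y.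
  by apply/rowP => i; rewrite !mxE; ring.
rewrite -/p; clearbody p y; rewrite dotBr dotZr (dotC (p - _) p).
rewrite (dotC (p - _) y) !dotBr !dotZr (dotC y p) => h.
have : e * (2 * dot p y) <= e * (e * dot y y) by lra.
rewrite ler_pM2l// => h2.
lra.
Qed.

End dot.

(** * The feature map at the data sites *)

Section features.
Context {R : realType} {X : Type} {Xi : ptopologicalType}.
Variables (kappa : X -> Xi -> R) (N : nat) (x : 'I_N -> X).
Hypothesis kappa_C0 : forall i, C0 (kappa (x i)).

Definition feature (xi : Xi) : 'rV[R]_N := \row_i kappa (x i) xi.

Lemma feature_continuous : continuous feature.
Proof.
move=> xi U /nbhs_ballP[e e0 eU]; apply: filterS eU _.
have : \forall eta \near xi, forall i, ball (kappa (x i) xi) e (kappa (x i) eta).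
  apply: filter_forall => i; have [c _] := kappa_C0 i.
  by apply: c; exact: nbhsx_ballx.
by apply: filterS => eta h; split => // j i; rewrite !mxE; exact: h.
Qed.

(** The maximum norm is attained at some coordinate, so the set lies in a finite union of the
    corresponding compact sets for the functions [kappa (x i)]. *)
Lemma feature_vanish (e : R) : 0 < e -> compact [set xi | e <= `|feature xi|].
Proof.
move=> e0; pose F i := [set xi | e <= `|kappa (x i) xi|].
have cF : compact (\big[setU/set0]_(i < N) F i).
  by apply: bigsetU_compact => i _; have [_] := kappa_C0 i; apply.
apply: (subclosed_compact _ cF); first exact: closed_normr_ge feature_continuous _.
move=> xi /= exi.
have /mx_norm_neq0[[i j] ij] : mx_norm (feature xi) != 0.
  by rewrite gt_eqF//; exact: lt_le_trans e0 exi.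
rewrite (bigD1 j)//=; left.
by move: exi; rewrite /F/= [X in _ <= X]ij/= mxE.
Qed.

End features.

(** * Atomic representation and minimization *)

Section representation.
Context {R : realType} {X : Type} {Xi : ptopologicalType}.
Variables (kappa : X -> Xi -> R) (N : nat) (x : 'I_N -> X).
Hypothesis kappa_C0 : forall i, C0 (kappa (x i)).

Local Notation phi := (feature kappa x).
Local Notation phi0 := (range phi `|` [set 0]).

Lemma feature0_compact : compact phi0.
Proof.
apply: vanishing_range_compact => [|e e0].
  exact: feature_continuous.
exact: feature_vanish.
Qed.

Lemma feature_sumE K (a : 'I_K -> R) (xi : 'I_K -> Xi) :
  \sum_j a j *: phi (xi j) = \row_i \sum_j a j * kappa (x i) (xi j).
Proof.
by apply/rowP => i; rewrite summxE mxE; apply: eq_bigr => j _; rewrite !mxE.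
Qed.

Lemma feature_atoms K (B : R) (a : 'I_K -> R) (xi : 'I_K -> Xi) :
  \sum_j `|a j| <= B ->
  atoms phi0 B K (\sum_j a j *: phi (xi j), \sum_j `|a j|).
Proof.
move=> aB; exists a, (phi \o xi); split => //.
  by move=> j; apply: le_trans aB; rewrite (bigD1 j)//= lerDl sumr_ge0.
by move=> j; left; exists (xi j).
Qed.

Lemma atoms_feature K (B : R) p : atoms phi0 B K p ->
  exists (a : 'I_K -> R) (xi : 'I_K -> Xi),
    \sum_j a j *: phi (xi j) = p.1 /\ \sum_j `|a j| <= p.2.
Proof.
move=> [a [u [_ uA ->]]] /=.
have /choice[f fP] : forall j, exists q : R * Xi,
    q.1 *: phi q.2 = a j *: u j /\ `|q.1| <= `|a j|.
  move=> j; have [[xi _ <-]|->] := uA j; first by exists (a j, xi).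
  (* A vector [0] outside the range of [phi] is replaced by a zero weight. *)
  by exists (0, point); rewrite scale0r scaler0 normr0.
exists (fun j => (f j).1), (fun j => (f j).2); split.
  by apply: eq_bigr => j _; have [] := fP j.
by apply: ler_sum => j _; have [] := fP j.
Qed.

Lemma dot_featureE (p : 'rV[R]_N) :
  (fun xi => dot p (phi xi)) = \sum_i p 0 i *: kappa (x i).
Proof.
by apply/funext => xi; rewrite fct_sumE; apply: eq_bigr => i _; rewrite mxE.
Qed.

Lemma charge_integral_dot (nu : signed_measure R Xi) (p : 'rV[R]_N) :
  charge_integral nu (fun xi => dot p (phi xi)) =
  dot p (\row_i Tk kappa nu (x i)).
Proof.
rewrite dot_featureE charge_integral_sum => [|i]; last exact: C0_bounded_borel.
by apply: eq_bigr => i _; rewrite mxE.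
Qed.

Lemma dot_feature_bounded_borel (p : 'rV[R]_N) :
  bounded_borel (fun xi => dot p (phi xi)).
Proof.
rewrite dot_featureE; apply: bounded_borel_sum => i; exact: C0_bounded_borel.
Qed.

Lemma atomic_representation K (nu : signed_measure R Xi) : (N <= K)%N ->
  exists (a : 'I_K -> R) (xi : 'I_K -> Xi),
    \sum_j a j *: phi (xi j) = \row_i Tk kappa nu (x i) /\
    \sum_j `|a j| <= tv_norm nu.
Proof.
move=> NK; set v := \row_i _; set t := tv_norm nu.
have t0 : 0 <= t := tv_norm_ge0 nu.
(* [atoms] bounds only the individual weights by [t]; the second condition bounds their sum. *)
pose E : set ('rV[R]_N * R) := atoms phi0 t K `&` [set p | p.2 <= t].
have cE : compact E.
  apply: compact_closedI; first exact/atoms_compact/feature0_compact.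
  apply: (@preimage_closed _ _ snd [set r : R | r <= t]); last exact: closed_le.
  by move=> q _; exact: cvg_snd.
pose D : set 'rV[R]_N := [set w | exists (a : 'I_K -> R) (xi : 'I_K -> Xi),
  \sum_j a j *: phi (xi j) = w /\ \sum_j `|a j| <= t].
have DE : D = fst @` E.
  apply/seteqP; split => [w [a [xi [<- at_]]]|_ [p [/atoms_feature[a [xi [aE al]]] pt] <-]].
    exists (\sum_j a j *: phi (xi j), \sum_j `|a j|) => //; split => //.
    exact: feature_atoms.
  by exists a, xi; split => //; exact: le_trans pt.
have cD : compact D.
  rewrite DE; apply: continuous_compact => //; apply: continuous_subspaceT => q.
  exact: cvg_fst.
have D0 : D !=set0.
  exists 0; exists (fun=> 0), (fun=> point); split.
    by rewrite big1// => j _; rewrite scale0r.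
  by rewrite big1// => j _; rewrite normr0.
have [w Dw wmin] : exists2 w, D w & forall y, D y ->
    dot (v - w) (v - w) <= dot (v - y) (v - y).
  have [||w Dw wmin] := @lower_semicontinuous_min R _ D
    (fun w => (dot (v - w) (v - w))%:E) cD D0.
  - by move=> w _; rewrite lee_fin dot_ge0.
  - apply/lower_semicontinuousP => b.
    rewrite (_ : mkset _ = (fun u => dot (v - u) (v - u)) @^-1` `]b, +oo[); last first.
      by apply/funext => u; rewrite /= lte_fin in_itv/= andbT.
    apply: open_comp; last exact: interval_open.
    by move=> u _; exact: dot_sub_continuous.
  by exists w => // y /wmin; rewrite lee_fin.
suff -> : v = w by [].
apply/eqP; rewrite -subr_eq0; apply/eqP; apply: dot_le0.
set p := v - w.
(* The segment from [w] to [s *: phi xi] stays in [D]: its points are sums of [K.+1] atoms of total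
   weight at most [t], and [drop_atom] removes one. *)
have key (s : R) xi : `|s| <= t -> s * dot p (phi xi) <= dot p w.
  move=> st; rewrite -dotZr; apply: nearest_point_dot_le0 wmin _ => e e0 e1.
  have [a [eta [<- at_]]] := Dw.
  have [b [zeta [bE bl]]] := drop_atom phi
    (ord_rcons (fun j => (1 - e) * a j) (e * s)) (ord_rcons eta xi) NK.
  exists b, zeta; split.
    rewrite bE big_ord_recr/= !ord_rcons_max scalerA scaler_sumr; congr (_ + _).
    by apply: eq_bigr => j _; rewrite !ord_rcons_widen scalerA.
  apply: (le_trans bl); rewrite big_ord_recr/= ord_rcons_max.
  under eq_bigr => j _ do rewrite ord_rcons_widen normrM.
  rewrite -mulr_sumr normrM (ger0_norm (ltW e0)) ger0_norm ?subr_ge0//.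
  apply: (@le_trans _ _ ((1 - e) * t + e * t)); last by rewrite -mulrDl subrK mul1r.
  by rewrite lerD// ler_wpM2l// ?subr_ge0// ltW.
have pw0 : 0 <= dot p w.
  by have := key 0 point; rewrite normr0 mul0r; apply.
have bg := dot_feature_bounded_borel p.
suff : dot p v <= dot p w by rewrite -subr_le0 -dotBr.
rewrite -charge_integral_dot.
(* When [t] is 0 the integral against [nu] vanishes and [pw0] concludes; otherwise [key] at [t] and
   [- t] bounds the integrand by [dot p w / t]. *)
have [tp|] := ltP 0 t; last first.
  move=> tle; have [M pM] := bg.2.
  have := ler_norm_charge_integral nu bg pM.
  have -> : tv_norm nu = 0 by apply/eqP; rewrite eq_le tle.
  rewrite mulr0 normr_le0 => /eqP ->; exact: pw0.
have hM xi : `|dot p (phi xi)| <= dot p w / t.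
  rewrite ler_pdivlMr// -(ger0_norm t0) -normrM ler_norml.
  have h1 := key t xi; have h2 := key (- t) xi.
  rewrite normrN ger0_norm// in h1 h2.
  by move: (h1 (lexx _)) (h2 (lexx _)) => ? ?; apply/andP; split; lra.
have := ler_norm_charge_integral nu bg hM.
rewrite -/t divfK ?gt_eqF//; apply: le_trans; exact: ler_norm.
Qed.

End representation.

Lemma lower_semicontinuous_add_linear (R : realType) (T : topologicalType)
    (G : T -> \bar R) (lambda : R) :
  (forall v, (0 <= G v)%E) -> lower_semicontinuous G -> 0 < lambda ->
  lower_semicontinuous (fun p : T * R => (G p.1 + (lambda * p.2)%:E)%E).
Proof.
move=> G0 lG l0 [v t] a /= aGt.
(* The level [a] is split into [c], strictly below [G v], and [a - c], strictly below [lambda * t];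
   both inequalities persist nearby. *)
have [c [cG ac]] : exists c : R, (c%:E < G v)%E /\ a - lambda * t < c.
  move: aGt (G0 v); case: (G v) => [r| |]//=.
    rewrite -EFinD lte_fin => ar _; exists ((a - lambda * t + r) / 2).
    by rewrite lte_fin; split; lra.
  by move=> _ _; exists (a - lambda * t + 1); rewrite ltry ltrDl ltr01.
have [V vV VG] := lG _ _ cG.
exists (V `*` `](a - c) / lambda, +oo[).
  exists (V, `](a - c) / lambda, +oo[%classic) => //; split => //=.
  apply: open_nbhs_nbhs; split; first exact: interval_open.
  by rewrite /= in_itv/= andbT ltr_pdivrMr//; lra.
move=> [y s] [/= /VG cy]; rewrite in_itv/= andbT ltr_pdivrMr// => acs.
apply: (@lt_trans _ _ (c%:E + (lambda * s)%:E)%E).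
  by rewrite -EFinD lte_fin; lra.
by rewrite lteD2rE.
Qed.

(** * Existence of minimizers and comparison of the two problems *)

Section minimization.
Context {R : realType} {X : Type} {Xi : ptopologicalType}.
Variables (kappa : X -> Xi -> R) (N : nat) (x : 'I_N -> X).
Variables (G : 'rV[R]_N -> \bar R) (lambda : R).
Hypothesis kernel : irkbs_kernel kappa.
Hypothesis G_ge0 : forall v, (0 <= G v)%E.
Hypothesis G_lsc : lower_semicontinuous G.
Hypothesis lambda_gt0 : 0 < lambda.

Local Notation phi := (feature kappa x).

Let kappa_C0 i : C0 (kappa (x i)).
Proof. by case: kernel. Qed.

Lemma objKE K (p : ('I_K -> R) * ('I_K -> Xi)) : objK kappa x G lambda p =
  (G (\sum_j p.1 j *: phi (p.2 j)) + (lambda * \sum_j `|p.1 j|)%:E)%E.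
Proof. by rewrite feature_sumE. Qed.

Lemma le_objective (v : 'rV[R]_N) (r s : R) : r <= s ->
  (G v + (lambda * r)%:E <= G v + (lambda * s)%:E)%E.
Proof. by move=> rs; rewrite leeD2l// lee_fin ler_pM2l. Qed.

(** The parameters range over a space that need not be compact, so the minimum is taken over pairs
    (vector, total weight) in [atoms] and pulled back by [atoms_feature], which cannot increase the
    objective. *)
Lemma objK_minimizers_nonempty K :
  minimizers setT (objK kappa x G lambda (K := K)) !=set0.
Proof.
(* If the objective is infinite everywhere, any parameters minimize it. *)
have [[p0 p0y]|np] := pselect (exists p0,
    (objK kappa x G lambda (K := K) p0 < +oo)%E); last first.
  exists (fun=> 0, fun=> point); split => // p _.
  have [py|] := ltP (objK kappa x G lambda p) +oo%E; first by exfalso; apply: np; exists p.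
  by move=> /(le_trans (leey _)).
pose r := fine (objK kappa x G lambda p0).
have obj0 p : (0 <= objK kappa x G lambda (K := K) p)%E.
  rewrite adde_ge0// lee_fin mulr_ge0 ?(ltW lambda_gt0)//.
  exact: sumr_ge0.
have rE : objK kappa x G lambda p0 = r%:E by rewrite fineK// ge0_fin_numE.
(* As [G] is nonnegative, parameters doing at least as well as [p0] have total weight at most
   [r / lambda]. *)
pose D := atoms (range phi `|` [set 0]) (r / lambda) K.
have inD p : (objK kappa x G lambda (K := K) p <= r%:E)%E ->
    D (\sum_j p.1 j *: phi (p.2 j), \sum_j `|p.1 j|).
  move=> pr; apply: feature_atoms; rewrite ler_pdivlMr// mulrC -lee_fin.
  by apply: le_trans pr; rewrite /objK leeDr.
have cD : compact D by apply: atoms_compact; exact: feature0_compact.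
have [||t Dt tmin] := lower_semicontinuous_min cD _ _
    (lower_semicontinuous_add_linear G_ge0 G_lsc lambda_gt0).
- by exists (\sum_j p0.1 j *: phi (p0.2 j), \sum_j `|p0.1 j|); apply: inD; rewrite rE.
- move=> p [a [u [_ _ ->]]] /=; rewrite adde_ge0// lee_fin mulr_ge0 ?(ltW lambda_gt0)//.
  exact: sumr_ge0.
have [a [xi [aE al]]] := atoms_feature Dt.
exists (a, xi); split => // q _.
have le_t : (objK kappa x G lambda (a, xi) <= G t.1 + (lambda * t.2)%:E)%E.
  by rewrite objKE/= aE; exact: le_objective.
have [qr|/ltW rq] := leP (objK kappa x G lambda q) r%:E.
  apply: (le_trans le_t); apply: (le_trans (tmin _ (inD _ qr))).
  by rewrite objKE.
apply: (le_trans le_t); apply: le_trans rq.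
have := tmin _ (inD p0 _); rewrite rE => /(_ (lexx _)) /le_trans; apply.
by rewrite -rE objKE.
Qed.

Hypothesis Xi_lc : locally_compact [set: Xi].
Hypothesis Xi_h : hausdorff_space Xi.

Lemma objP_atomic_le K (a : 'I_K -> R) (xi : 'I_K -> Xi) :
  (objP kappa x G lambda (atomic kappa (a, xi)) <= objK kappa x G lambda (a, xi))%E.
Proof. by apply: le_objective; have [] := atomic_irkbs Xi_lc Xi_h kernel a xi. Qed.

Lemma objK_le_objP K f : (N <= K)%N -> irkbs kappa f ->
  exists p, (objK kappa x G lambda (K := K) p <= objP kappa x G lambda f)%E.
Proof.
move=> NK [nu rnu <-].
have [a [xi [aE al]]] := atomic_representation kappa_C0 nu NK.
exists (a, xi); rewrite objKE/= aE /objP irkbs_normE//.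
exact: le_objective.
Qed.

(** The problems dominate each other: passing from parameters to their atomic function does not
    raise the objective, and each [f] is matched by parameters doing no worse. *)
Lemma objK_minimizer_objP K (a : 'I_K -> R) (xi : 'I_K -> Xi) : (N <= K)%N ->
  minimizers setT (objK kappa x G lambda (K := K)) (a, xi) ->
  minimizers (irkbs kappa) (objP kappa x G lambda) (atomic kappa (a, xi)).
Proof.
move=> NK [_ amin]; split.
  by have [] := atomic_irkbs Xi_lc Xi_h kernel a xi.
move=> f /(objK_le_objP NK)[p pf].
by apply: (le_trans (objP_atomic_le _ _)); apply: le_trans pf; exact: amin.
Qed.

(** A vector where [G] is finite is a combination of features, hence the vector of values of an
    atomic function at the data sites. *)
Lemma objP_proper : proper_on setT G -> lin_span (range phi) = setT ->
  proper_on (irkbs kappa) (objP kappa x G lambda).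
Proof.
move=> [v _ Gv] spanT.
have [n [c [u [uphi vE]]]] : lin_span (range phi) v by rewrite spanT.
have /choice[xi xiE] : forall i, exists xi, phi xi = u i.
  by move=> i; have [xi _ <-] := uphi i; exists xi.
exists (atomic kappa (c, xi)).
  by have [] := atomic_irkbs Xi_lc Xi_h kernel c xi.
apply: (le_lt_trans (objP_atomic_le _ _)); rewrite objKE/=.
under eq_bigr do rewrite xiE.
by rewrite -vE lte_add_pinfty// ltry.
Qed.

End minimization.

Unset Implicit Arguments.
Theorem theorem7p12 (R : realType) (X : metricType R) (Xi : ptopologicalType)
    (X_separable : separable X)
    (Xi_second_countable : @second_countable Xi)
    (Xi_locally_compact : locally_compact [set: Xi])
    (Xi_hausdorff : hausdorff_space Xi)
    (L : R) (kappa : X -> Xi -> R)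
    (kappa_irkbs : irkbs_kernel kappa)
    (kappa_lipschitz : lipschitz_kernel L kappa)
    (N : nat) (x : 'I_N -> X) (x_distinct : injective x)
    (G : 'rV[R]_N -> \bar R)
    (G_ge0 : forall v, (0 <= G v)%E)
    (G_proper : proper_on setT G)
    (G_lsc : lower_semicontinuous G)
    (G_coercive : coercive G)
    (lambda : R) (lambda_gt0 : 0 < lambda) :
  (proper_on (irkbs kappa) (objP kappa x G lambda) ->
     minimizers (irkbs kappa) (objP kappa x G lambda) !=set0 /\
     exists (K : nat) (a : 'I_K -> R) (xi : 'I_K -> Xi),
       (K <= N)%N /\
       minimizers (irkbs kappa) (objP kappa x G lambda)
         (atomic kappa (a, xi))) /\
  (lin_span (range (fun xi : Xi => \row_(i < N) kappa (x i) xi)) = setT ->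
     proper_on (irkbs kappa) (objP kappa x G lambda) /\
     forall K : nat, (N <= K)%N ->
       minimizers setT (objK kappa x G lambda (K := K)) !=set0 /\
       forall (a : 'I_K -> R) (xi : 'I_K -> Xi),
         minimizers setT (objK kappa x G lambda (K := K)) (a, xi) ->
         minimizers (irkbs kappa) (objP kappa x G lambda)
           (atomic kappa (a, xi))).
Proof.
have kerP := @objK_minimizer_objP R X Xi kappa N x G lambda kappa_irkbs
  lambda_gt0 Xi_locally_compact Xi_hausdorff.
have exK := @objK_minimizers_nonempty R X Xi kappa N x G lambda kappa_irkbs
  G_ge0 G_lsc lambda_gt0.
split=> [_|spanT].
  (* A minimizer of the atomic problem with exactly [N] atoms yields both existence and the required
     form. *)
  have [[a xi] /(kerP _ _ _ (leqnn N)) amin] := exK N.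
  by split; [exists (atomic kappa (a, xi)) | exists N, a, xi].
split; first exact: objP_proper.
by move=> K NK; split=> [|a xi]; [exact: exK | exact: kerP].
Qed.
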